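(* Let $B$ be a commutative ring, let $A$ be a ring that is a free right $B$-module of rank $m$, and let $r\ge1$. Then the Study-type determinant $\mathrm{Sdet}_{\mathrm{M}(r,A)}^{B}:\mathrm{M}(r,A)\to B$ has the following properties: (1) it is multiplicative: $\mathrm{Sdet}_{\mathrm{M}(r,A)}^{B}(aa')=\mathrm{Sdet}_{\mathrm{M}(r,A)}^{B}(a)\,\mathrm{Sdet}_{\mathrm{M}(r,A)}^{B}(a')$ for all $a,a'\in \mathrm{M}(r,A)$; (2) it is an invertibility preserving map: for every $a\in \mathrm{M}(r,A)$, $a$ is invertible in $\mathrm{M}(r,A)$ if and only if $\mathrm{Sdet}_{\mathrm{M}(r,A)}^{B}(a)$ is invertible in $B$.
   Context: Rings have a multiplicative unit; $\mathrm{M}(k,R)$ is the ring of $k\times k$ matrices over $R$. ''$A$ is a free right $B$-module of rank $m$'' means that $B$ is a subring of $A$ and $A=\bigoplus_{i=1}^m e_iB$ for some ordered basis $e=(e_1,\dots,e_m)$. For such rings the left regular representation $L_e:A\to \mathrm{M}(m,B)$, $a\mapsto(b_{ij})$, is defined by $ae_j=\sum_ie_ib_{ij}$. Also $\mathrm{M}(r,A)=\bigoplus_{i=1}^m(e_iI_r)\mathrm{M}(r,B)$ is a free right $\mathrm{M}(r,B)$-module of rank $m$; let $L:\mathrm{M}(r,A)\to \mathrm{M}(m,\mathrm{M}(r,B))$ be a left regular representation (e.g. with respect to $(e_1I_r,\dots,e_mI_r)$). The Study-type determinant is $\mathrm{Sdet}_{\mathrm{M}(r,A)}^B:=\det\circ\,\iota\circ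 L$, where $\iota:\mathrm{M}(m,\mathrm{M}(r,B))\hookrightarrow \mathrm{M}(mr,B)$ is the inclusion (block matrices viewed as $mr\times mr$ matrices) and $\det:\mathrm{M}(mr,B)\to B$ is the determinant; it does not depend on the choice of basis. *)

(* Defs.v *)
From HB Require Import structures.
From mathcomp Require Import all_boot all_order all_algebra.

Set Implicit Arguments.
Unset Strict Implicit.
Unset Printing Implicit Defensive.

Import GRing.Theory.
Local Open Scope ring_scope.

(* Stated by hand since GRing.unit needs a unitRingType, which matrices over   *)
(* a noncommutative ring are not.                                             *)
Definition invertible (R : pzRingType) (x : R) : Prop :=
  exists y : R, x * y = 1 /\ y * x = 1.

Section RightBasis.
Variables (B A : pzRingType) (f : {rmorphism B -> A}).

(* A is a right B-module via x . b := x * f b; the inclusion of a subring B   *)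
(* of A is an injective f.                                                    *)
Definition is_right_basis m (e : 'I_m -> A) : Prop :=
  forall x : A, exists! c : 'cV[B]_m, x = \sum_(i < m) e i * f (c i 0).

Record right_basis m := RightBasis {
  right_basis_elt :> 'I_m -> A;
  right_basisP : is_right_basis right_basis_elt }.

Definition right_free_of_rank m : Prop :=
  exists e : 'I_m -> A, is_right_basis e.

Section Coordinates.
Variables (m : nat) (e : right_basis m).

Lemma right_coord_subproof (x : A) :
  exists c : 'cV[B]_m, x == \sum_(i < m) e i * f (c i 0).
Proof. by have [c [xE _]] := right_basisP e x; exists c; apply/eqP. Qed.

Definition right_coord (x : A) : 'cV[B]_m := xchoose (right_coord_subproof x).

Lemma right_coordE (x : A) : x = \sum_(i < m) e i * f (right_coord x i 0).
Proof. exact/eqP/(xchooseP (right_coord_subproof x)). Qed.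

Definition left_regular (a : A) : 'M[B]_m :=
  \matrix_(i, j) right_coord (a * e j) i 0.

Lemma left_regularE (a : A) (j : 'I_m) :
  a * e j = \sum_(i < m) e i * f (left_regular a i j).
Proof.
by rewrite [LHS]right_coordE; apply: eq_bigr => i _; rewrite !mxE.
Qed.

End Coordinates.
End RightBasis.

Section StudyDeterminant.
Variables (B : comPzRingType) (A : pzRingType) (f : {rmorphism B -> A}).
Variables (m r : nat).

(* Bases of M(r, A) as a right M(r, B)-module, for M(r, B) acting through the *)
(* entrywise image under f.                                                   *)
Definition mx_right_basis : Type :=
  @right_basis 'M[B]_r 'M[A]_r (@map_mx B A f r r) m.

Lemma scalar_mx_is_right_basis (e : right_basis f m) :
  is_right_basis (@map_mx B A f r r : {rmorphism 'M[B]_r -> 'M[A]_r})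
    (fun i : 'I_m => (e i)%:M : 'M[A]_r).
Proof.
have entryE (c : 'cV['M[B]_r]_m) k l :
    (\sum_(i < m) (e i)%:M * map_mx f (c i 0) : 'M[A]_r) k l
      = \sum_(i < m) e i * f (c i 0 k l).
  rewrite summxE; apply: eq_bigr => i _.
  by rewrite -[_ * _]/(_ *m _) mul_scalar_mx !mxE.
move=> X; exists (\col_i \matrix_(k, l) right_coord e (X k l) i 0); split.
  apply/matrixP => k l; rewrite entryE [LHS](right_coordE e).
  by apply: eq_bigr => i _; rewrite !mxE.
move=> c XE; apply/matrixP => i j; rewrite ord1 mxE.
apply/matrixP => k l; rewrite mxE.
have [d [_ dU]] := right_basisP e (X k l).
rewrite -(dU _ (right_coordE e (X k l))).
suff -> : d = \col_i c i 0 k l by rewrite mxE.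
by apply: dU; rewrite {1}XE entryE; apply: eq_bigr => n _; rewrite mxE.
Qed.

Definition scalar_mx_right_basis (e : right_basis f m) : mx_right_basis :=
  RightBasis (scalar_mx_is_right_basis e).

(* The dimension \sum_(i < m) r of the block matrix is m * r.                 *)
Definition Sdet (E : mx_right_basis) (a : 'M[A]_r) : B :=
  \det (\mxblock_(i < m, j < m) left_regular E a i j).

End StudyDeterminant.

(* Main.v *)
Require Import Defs.
From HB Require Import structures.
From mathcomp Require Import all_boot all_order all_algebra.

Set Implicit Arguments.
Unset Strict Implicit.
Unset Printing Implicit Defensive.

Import GRing.Theory.
Local Open Scope ring_scope.

(* Left multiplication by a is an endomorphism of a free right module, with   *)
(* matrix L(a), so L is an injective ring morphism. If L(a) has an inverse N, *)
(* the element b whose coordinates are N times those of 1 satisfies a b = 1;  *)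
(* hence L(b) = N and L(b a) = 1, so b a = 1. Flattening blocks is a ring     *)
(* isomorphism, and over a commutative ring a matrix is invertible exactly    *)
(* when its determinant is.                                                   *)

(** Three equivalences are chained: [invertible_left_regular], [invertible_flatten_mx] and
    [invertible_det]. The first is the delicate one, as an inverse of L(a) is not known beforehand
    to lie in the image of L. It is applied to 'M[A]_r over 'M[B]_r, so scalars here may not
    commute; commutativity of B enters with the determinant. *)

Section LeftRegular.
Variables (R S : pzRingType) (f : {rmorphism R -> S}) (m : nat).
Variable e : right_basis f m.

Lemma right_comb_inj (c d : 'cV[R]_m) :
  \sum_(i < m) e i * f (c i 0) = \sum_(i < m) e i * f (d i 0) -> c = d.
Proof.
move=> eq_cd; have [u [_ uU]] := right_basisP e (\sum_(i < m) e i * f (c i 0)).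
by rewrite -(uU c erefl) -(uU d eq_cd).
Qed.

(** Left multiplication is right linear, so it acts on coordinate columns through L(a); scalars on
    the right give the product order of [*m]. *)
Lemma mul_right_comb (a : S) (c : 'cV[R]_m) :
  a * (\sum_(j < m) e j * f (c j 0))
    = \sum_(i < m) e i * f ((left_regular e a *m c) i 0).
Proof.
rewrite mulr_sumr.
under eq_bigr => j _ do rewrite mulrA left_regularE mulr_suml.
rewrite exchange_big; apply: eq_bigr => i _.
rewrite mxE rmorph_sum mulr_sumr; apply: eq_bigr => j _.
by rewrite rmorphM mulrA.
Qed.

Lemma left_regular_unique (a : S) (M : 'M[R]_m) :
  (forall j, a * e j = \sum_(i < m) e i * f (M i j)) -> left_regular e a = M.
Proof.
move=> aE; apply/matrixP => i j.
suff /matrixP/(_ i 0) : col j (left_regular e a) = col j M by rewrite !mxE.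
apply: right_comb_inj; under eq_bigr do rewrite mxE.
by rewrite -left_regularE aE; apply: eq_bigr => k _; rewrite mxE.
Qed.

Lemma left_regularM (a b : S) :
  left_regular e (a * b) = left_regular e a * left_regular e b.
Proof.
apply: left_regular_unique => j; rewrite -mulrA.
have -> : b * e j = \sum_(i < m) e i * f (col j (left_regular e b) i 0).
  by rewrite left_regularE; apply: eq_bigr => i _; rewrite !mxE.
rewrite mul_right_comb; apply: eq_bigr => i _; rewrite !mxE.
by congr (_ * f _); apply: eq_bigr => k _; rewrite !mxE.
Qed.

Lemma left_regular1 : left_regular e 1 = 1.
Proof.
apply: left_regular_unique => j; rewrite mul1r (bigD1 j) //= mxE eqxx rmorph1.
by rewrite mulr1 big1 ?addr0 // => i /negPf ij; rewrite mxE ij rmorph0 mulr0.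
Qed.

(** Since a = a * 1, L(a) and the coordinates of 1 determine a; 1 need not be a basis element. *)
Lemma left_regular_inj : injective (left_regular e).
Proof.
move=> a b eq_ab; rewrite -[a]mulr1 -[b]mulr1 [1](right_coordE e).
by rewrite !mul_right_comb eq_ab.
Qed.

Lemma invertible_left_regular (a : S) :
  invertible (left_regular e a) <-> invertible a.
Proof.
split=> [[N [LN1 NL1]] | [b [ab1 ba1]]]; last first.
  by exists (left_regular e b); rewrite -!left_regularM ab1 ba1 left_regular1.
(* The choice is forced: if L(b) = N, then b = b * 1 has these coordinates. *)
pose b := \sum_(i < m) e i * f ((N *m right_coord e 1) i 0).
have ab1 : a * b = 1.
  by rewrite mul_right_comb mulmxA [_ *m N]LN1 mul1mx -right_coordE.
(* L(b) = N L(a) L(b) = N L(a b) = N. *)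
have LbN : left_regular e b = N.
  by rewrite -[LHS]mul1r -NL1 -mulrA -left_regularM ab1 left_regular1 mulr1.
exists b; split=> //; apply: left_regular_inj.
by rewrite left_regularM LbN left_regular1.
Qed.

End LeftRegular.

Section Flatten.
Variables (R : pzRingType) (m r : nat).

Definition flatten_mx (M : 'M['M[R]_r]_m) : 'M[R]_(\sum_(i < m) r) :=
  \mxblock_(i < m, j < m) M i j.

Lemma flatten_mx_inj : injective flatten_mx.
Proof. by move=> M N /eq_mxblockP MN; apply/matrixP => i j; exact: MN. Qed.

Lemma flatten_mx_surj (X : 'M[R]_(\sum_(i < m) r)) :
  exists M, flatten_mx M = X.
Proof.
exists (\matrix_(i, j) submxblock X i j); rewrite -[RHS]submxblockK.
by apply/eq_mxblockP => i j; rewrite mxE.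
Qed.

Lemma flatten_mxM (M N : 'M['M[R]_r]_m) :
  flatten_mx (M * N) = flatten_mx M * flatten_mx N.
Proof.
by rewrite [RHS]mul_mxblock; apply/eq_mxblockP => i j; rewrite mxE.
Qed.

(** A surjective multiplicative map preserves the unit, which avoids comparing entries of the block
    identity. *)
Lemma flatten_mx1 : flatten_mx 1 = 1.
Proof.
have [J J1] := flatten_mx_surj 1.
by rewrite -[LHS]mulr1 -J1 -flatten_mxM mul1r.
Qed.

Lemma invertible_flatten_mx (M : 'M['M[R]_r]_m) :
  invertible (flatten_mx M) <-> invertible M.
Proof.
split=> [[X] | [N [MN NM]]]; last first.
  by exists (flatten_mx N); rewrite -!flatten_mxM MN NM flatten_mx1.
have [N <-] := flatten_mx_surj X; rewrite -!flatten_mxM -flatten_mx1.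
by case=> MN NM; exists N; split; apply: flatten_mx_inj.
Qed.

End Flatten.

Lemma invertible_det (R : comPzRingType) n (M : 'M[R]_n) :
  invertible (\det M) <-> invertible M.
Proof.
split=> [[y [dy _]] | [N [MN NM]]]; last first.
  by exists (\det N); rewrite -!det_mulmx [M *m N]MN [N *m M]NM det1.
(* Cramer's rule: the adjugate scaled by the inverse y of the determinant inverts M on both
   sides. *)
have ydM : y *: (\det M)%:M = 1 :> 'M_n by rewrite scale_scalar_mx mulrC dy.
exists (y *: \adj M); split.
  by rewrite -[LHS]scalemxAr mul_mx_adj.
by rewrite -[LHS]scalemxAl mul_adj_mx.
Qed.

Theorem lemma6p2 (B : comPzRingType) (A : pzRingType)
    (f : {rmorphism B -> A}) (f_inj : injective f) (m : nat)
    (A_free : right_free_of_rank f m) (r : nat) (r_gt0 : (1 <= r)%N)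
    (E : mx_right_basis f m r) :
  (forall a a' : 'M[A]_r, Sdet E (a * a') = Sdet E a * Sdet E a') /\
  (forall a : 'M[A]_r, invertible a <-> invertible (Sdet E a)).
Proof.
have SdetE a : Sdet E a = \det (flatten_mx (left_regular E a)) by [].
split=> [a a' | a]; first by rewrite !SdetE left_regularM flatten_mxM det_mulmx.
apply: iff_sym; apply: iff_trans (invertible_det _) _.
apply: iff_trans (invertible_flatten_mx _) _.
exact: invertible_left_regular.
Qed.
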